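(* Let $\varepsilon\ge 0$. Any symmetric matrix $\mathrm M\in\mathbb R^{k\times k}$ can be decomposed as $\mathrm M=\mathrm B_1^{\intercal}\mathrm B_1-\mathrm B_0^{\intercal}\mathrm B_0$ for some $\mathrm B_0\in\mathbb R^{r_0\times k}$, $\mathrm B_1\in\mathbb R^{r_1\times k}$ with $r_0,r_1\le k$. With such a decomposition, the problem $$\text{(V)}\qquad \inf_{u\in\mathbb R^{r_0}}\sup_{v\in\mathbb R^{r_1}}\Big\{\tfrac12\|u\|^2-\tfrac12\|v\|^2+\inf_{x\in\mathcal K}\big\{(\mathrm B_1^{\intercal}v-\mathrm B_0^{\intercal}u)^{\intercal}x-\varepsilon\mathsf H(x)\big\}\Big\}$$ is equivalent to $$\text{(Q)}\qquad \inf_{x\in\mathcal K}\big\{\tfrac12x^{\intercal}\mathrm Mx-\varepsilon\mathsf H(x)\big\}$$ in the sense that the optimal values of (V) and (Q) coincide and: (1) If $x^\star$ solves (Q), then $(u^\star,v^\star)=(\mathrm B_0x^\star,\mathrm B_1x^\star)$ solves the outer inf-sup problem in (V), and $x^\star\in\operatorname{argmin}_{x\in\mathcal K}\{(\mathrm B_1^{\intercal}v^\star-\mathrm B_0^{\intercal}u^\star)^{\intercal}x-\varepsilon\mathsf H(x)\}$. (2) If, conversely, $(u^\star,v^\star)$ solves the outer inf-sup problem in (V), then there exists $\bar x\in\operatorname{argmin}_{x\in\mathcal K}\{(\mathrm B_1^{\intercal}v^\star-\mathrm B_0^{\intercal}u^\star)^{\intercal}x-\varepsilon\mathsf H(x)\}$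 which solves (Q) and satisfies $(u^\star,v^\star)=(\mathrm B_0\bar x,\mathrm B_1\bar x)$. Moreover, for every $u\in\mathbb R^{r_0}$, $$\operatorname{argmax}_{v\in\mathbb R^{r_1}}\Big\{\tfrac12\|u\|^2-\tfrac12\|v\|^2+\inf_{x\in\mathcal K}\big\{(\mathrm B_1^{\intercal}v-\mathrm B_0^{\intercal}u)^{\intercal}x-\varepsilon\mathsf H(x)\big\}\Big\}\subset\mathrm B_1\mathcal K .$$ Thus the outer inf and sup in (V) can be restricted to $\mathrm B_0\mathcal K$ and $\mathrm B_1\mathcal K$, respectively.
   Context: Let $\mathcal X_0=\{x_0^{(1)},\dots,x_0^{(N_0)}\}$ and $\mathcal X_1=\{x_1^{(1)},\dots,x_1^{(N_1)}\}$ be finite sets, $\mu_0,\mu_1$ probability measures on $\mathcal X_0,\mathcal X_1$, and $k=N_0N_1$. A coupling $\pi$ of $(\mu_0,\mu_1)$ is identified with the vector $x\in\mathbb R^k$ whose entry at index $(i-1)N_1+j$ is $\pi(\{(x_0^{(i)},x_1^{(j)})\})$. $\mathcal K\subset\mathbb R^k$ is the set of all vectors representing couplings of $(\mu_0,\mu_1)$: $\mathcal K=\{x\ge0:\ \sum_j x_{(i-1)N_1+j}=\mu_0(\{x_0^{(i)}\})\ \forall i,\ \sum_i x_{(i-1)N_1+j}=\mu_1(\{x_1^{(j)}\})\ \forall j\}$. $\mathsf H(x)=-\sum_{i=1}^kx_i\log x_i$ (with $0\log0=0$). $\mathrm B\mathcal K=\{\mathrm Bx:x\in\mathcal K\}$.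 Saying that $(u^\star,v^\star)$ solves the outer inf-sup problem in (V) means that $u^\star$ minimizes over $u\in\mathbb R^{r_0}$ the value of the inner supremum over $v$, and $v^\star$ attains the supremum over $v\in\mathbb R^{r_1}$ for $u=u^\star$. *)

(* Defs.v *)
From mathcomp Require Import all_boot all_order all_algebra.
From mathcomp Require Import all_classical all_reals all_analysis.

Set Implicit Arguments.
Unset Strict Implicit.
Unset Printing Implicit Defensive.

Import Order.TTheory GRing.Theory Num.Theory.

Local Open Scope classical_set_scope.
Local Open Scope ring_scope.

Section Argmin.
Context {T : Type} {disp : Order.disp_t} {V : porderType disp}.

Definition argmin (A : set T) (f : T -> V) : set T :=
  [set x | A x /\ forall y, A y -> (f x <= f y)%O].

Definition argmax (A : set T) (f : T -> V) : set T :=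
  [set x | A x /\ forall y, A y -> (f y <= f x)%O].

End Argmin.

(* With 0-based i and j, mxvec_index i j is the row-major position i * n + j,
   i.e. the 1-based position (i - 1) * n + j. *)
Lemma val_mxvec_index (m n : nat) (i : 'I_m) (j : 'I_n) :
  mxvec_index i j = (i * n + j)%N :> nat.
Proof.
have index_pairs (s : seq 'I_m) (t : seq 'I_n) : i \in s -> j \in t ->
    index (i, j) [seq (a, b) | a <- s, b <- t]
    = (index i s * size t + index j t)%N.
  move=> + jt; elim: s => [//|a s IHs]; rewrite inE /= index_cat.
  case: (eqVneq a i) => [->|ai].
    rewrite map_f // => _; rewrite mul0n add0n.
    by rewrite index_map // => b c [].
  case: (eqVneq i a) ai => [-> /eqP//|ia _] /= si.
  case: ifP => [/mapP[b _ [iE _]]|_]; first by rewrite iE eqxx in ia.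
  by rewrite size_map IHs // addnA mulSn.
rewrite /= /enum_rank enum_rank_in.unlock insubdK; last first.
  by rewrite -[_ \in _]/(_ < _)%N cardE index_mem mem_enum.
rewrite enumT Finite.enum.unlock /= /prod_enum.
rewrite index_pairs ?mem_enum // !index_enum_ord.
by rewrite size_enum_ord.
Qed.

Section QuadraticProgram.
Context {R : realType}.

(* Euclidean inner product; dot u u is the squared Euclidean norm, whereas
   `|u| on matrices is the sup norm. *)
Definition dot (n : nat) (u v : 'cV[R]_n) : R := (u^T *m v) ord0 ord0.

(* The convention 0 * log 0 = 0 holds since ln 0 = 0. *)
Definition entropy (n : nat) (x : 'cV[R]_n) : R :=
  - \sum_(i < n) x i ord0 * ln (x i ord0).

(* Vectors representing the couplings of mu0 and mu1, the points of the two
   spaces being enumerated by p0 and p1. *)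
Definition couplings {d0 d1 : measure_display}
    {T0 : measurableType d0} {T1 : measurableType d1} {N0 N1 : nat}
    (p0 : 'I_N0 -> T0) (p1 : 'I_N1 -> T1)
    (mu0 : probability T0 R) (mu1 : probability T1 R) :
    set 'cV[R]_(N0 * N1) :=
  [set x | [/\ forall l, 0 <= x l ord0,
    forall i : 'I_N0,
      (\sum_(j < N1) x (mxvec_index i j) ord0)%:E = mu0 [set p0 i] &
    forall j : 'I_N1,
      (\sum_(i < N0) x (mxvec_index i j) ord0)%:E = mu1 [set p1 j]]].

Definition Qobj {k : nat} (eps : R) (M : 'M[R]_k) (x : 'cV[R]_k) : R :=
  2^-1 * dot x (M *m x) - eps * entropy x.

Definition Qvalue {k : nat} (eps : R) (M : 'M[R]_k) (K : set 'cV[R]_k) :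
    \bar R :=
  ereal_inf [set (Qobj eps M x)%:E | x in K].

Section Variational.
Context {k r0 r1 : nat} (eps : R).
Context (B0 : 'M[R]_(r0, k)) (B1 : 'M[R]_(r1, k)) (K : set 'cV[R]_k).
Implicit Types (u : 'cV[R]_r0) (v : 'cV[R]_r1).

Definition innerobj u v (x : 'cV[R]_k) : R :=
  dot (B1^T *m v - B0^T *m u) x - eps * entropy x.

Definition Vobj u v : \bar R :=
  ((2^-1 * dot u u - 2^-1 * dot v v)%:E
   + ereal_inf [set (innerobj u v x)%:E | x in K])%E.

(* In the remaining definitions U and W are the sets over which the outer
   infimum and supremum are taken. *)
Definition Vsup (W : set 'cV[R]_r1) u : \bar R :=
  ereal_sup [set Vobj u v | v in W].

Definition Vvalue (U : set 'cV[R]_r0) (W : set 'cV[R]_r1) : \bar R :=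
  ereal_inf [set Vsup W u | u in U].

Definition Vsolves (U : set 'cV[R]_r0) (W : set 'cV[R]_r1) u v : Prop :=
  argmin U (Vsup W) u /\ argmax W (Vobj u) v.

End Variational.
End QuadraticProgram.

(* Main.v *)
(* For fixed u, put P_u(x) = |u|^2/2 + |B1 x|^2/2 - u.B0 x - eps H(x), which is
   convex on K and equals the objective of (Q) plus |u - B0 x|^2 / 2. If x
   minimizes P_u over K, the first-order optimality condition says that x also
   minimizes the inner objective at (u, B1 x); hence v = B1 x attains the value
   P_u(x), while every v yields at most P_u(x) - |v - B1 x|^2 / 2. So the inner
   supremum is min_K P_u, its only maximizer is B1 x, and minimizing over u adds
   the constraint u = B0 x and gives (Q). The decomposition of M is a Cholesky
   factorization of M + c I for large c, with B0 = sqrt(c) I. *)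
Require Import Defs.
From mathcomp Require Import all_boot all_order all_algebra.
From mathcomp Require Import all_classical all_reals all_analysis.
From mathcomp Require Import ring lra.

Import Order.TTheory GRing.Theory Num.Theory.
Import numFieldNormedType.Exports.

Local Open Scope classical_set_scope.
Local Open Scope ring_scope.

(** * The Euclidean inner product *)

Section DotProduct.
Context {R : realType} {n : nat}.
Implicit Types (a : R) (u v w : 'cV[R]_n).

Lemma dotE u v : dot u v = \sum_i u i ord0 * v i ord0.
Proof. by rewrite /dot mxE; apply: eq_bigr => i _; rewrite mxE. Qed.

Lemma dotC u v : dot u v = dot v u.
Proof. by rewrite !dotE; apply: eq_bigr => i _; rewrite mulrC. Qed.

Lemma dotDr u v w : dot u (v + w) = dot u v + dot u w.
Proof. by rewrite /dot mulmxDr mxE. Qed.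

Lemma dotDl u v w : dot (u + v) w = dot u w + dot v w.
Proof. by rewrite dotC dotDr !(dotC w). Qed.

Lemma dotZr a u v : dot u (a *: v) = a * dot u v.
Proof. by rewrite /dot -scalemxAr mxE. Qed.

Lemma dotZl a u v : dot (a *: u) v = a * dot u v.
Proof. by rewrite dotC dotZr dotC. Qed.

Lemma dotNr u v : dot u (- v) = - dot u v.
Proof. by rewrite -scaleN1r dotZr mulN1r. Qed.

Lemma dotBr u v w : dot u (v - w) = dot u v - dot u w.
Proof. by rewrite dotDr dotNr. Qed.

Lemma dotBl u v w : dot (u - v) w = dot u w - dot v w.
Proof. by rewrite dotC dotBr !(dotC w). Qed.

Lemma dot_ge0 u : 0 <= dot u u.
Proof. by rewrite dotE sumr_ge0 // => i _; rewrite -expr2 sqr_ge0. Qed.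

Lemma dot_eq0 u : dot u u = 0 -> u = 0.
Proof.
move=> u0; have := u0; rewrite dotE => /eqP.
rewrite psumr_eq0 => [/allP u_eq0|i _]; last by rewrite -expr2 sqr_ge0.
apply/colP => i; rewrite mxE; apply/eqP.
by have := u_eq0 i (mem_index_enum i); rewrite mulf_eq0 orbb.
Qed.

End DotProduct.

Lemma dot_trmx {R : realType} {m n : nat} (A : 'M[R]_(m, n)) u v :
  dot (A^T *m u) v = dot u (A *m v).
Proof. by rewrite /dot trmx_mul trmxK mulmxA. Qed.

(** * Convexity and continuity of [x * ln x] *)

Section Entropy.
Context {R : realType}.

(** The left side is the tangent at [z] to the convex function [a * ln a]; for [0 < a] the bound is
    [ln (1 + s) <= s] at [s = z / a - 1], multiplied by [a]. *)
Lemma xlnx_ge (z a : R) : 0 <= a -> 0 < z -> a * ln z + a - z <= a * ln a.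
Proof.
move=> a0 z0; case: (ltgtP 0 a) a0 => // [a0 _|<- _]; last first.
  by rewrite !mul0r !add0r oppr_le0 ltW.
have za0 : 0 < z / a by rewrite divr_gt0.
have : ln (1 + (z / a - 1)) <= z / a - 1 by apply: le_ln1Dx; lra.
rewrite (_ : 1 + _ = z / a); last by lra.
rewrite lnM ?posrE ?invr_gt0 // lnV ?posrE // => le_ln.
have : a * (ln z - ln a) <= a * (z / a - 1) by rewrite ler_pM2l.
rewrite [a * (z / a - 1)](_ : _ = z - a); last by field; rewrite gt_eqF.
lra.
Qed.

(** The tangent bounds at the intermediate point [z], weighted by [1 - t] and [t], add up to
    [z * ln z]. *)
Lemma xlnx_convex (t a b : R) : 0 <= t <= 1 -> 0 <= a -> 0 <= b ->
  (a + t * (b - a)) * ln (a + t * (b - a))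
  <= a * ln a + t * (b * ln b - a * ln a).
Proof.
move=> /andP[t0 t1] a0 b0; set z := a + t * (b - a).
have zE : z = (1 - t) * a + t * b by rewrite /z; ring.
have z0 : 0 <= z by rewrite zE addr_ge0 ?mulr_ge0 ?subr_ge0.
have t'0 : 0 <= 1 - t by rewrite subr_ge0.
case: (ltgtP 0 z) z0 => // [z0 _|z0 _].
  have := ler_wpM2l t'0 (xlnx_ge z a a0 z0).
  have := ler_wpM2l t0 (xlnx_ge z b b0 z0).
  move=> hb ha; have := lerD ha hb.
  rewrite [X in X <= _](_ : _ = z * ln z); last first.
    by move: (ln z) => l; rewrite zE; ring.
  move=> /le_trans; apply.
  by rewrite le_eqVlt; apply/orP; left; apply/eqP; ring.
(* There is no tangent at [z = 0], but then both weighted terms vanish and so do both sides. *)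
have /eqP : (1 - t) * a + t * b = 0 by rewrite -zE.
rewrite paddr_eq0 ?mulr_ge0 // => /andP[/eqP ta0 /eqP tb0].
rewrite -z0 mul0r le_eqVlt; apply/orP; left; apply/eqP.
transitivity (((1 - t) * a) * ln a + (t * b) * ln b); last by ring.
by rewrite ta0 tb0 !mul0r addr0.
Qed.

(** Continuity is needed on the whole line, because minimizers are later obtained for functions
    continuous on the whole space. On negative numbers [ln] is 0, so only the point 0 is
    delicate. *)
Lemma xlnx_continuous : continuous (fun x : R => x * ln x).
Proof.
move=> x; have [x0|x0|->] := ltgtP x 0.
- apply: (@near_cst_continuous _ _ 0); last first.
  near=> y; rewrite ln0 ?mulr0 //.
  by apply: ltW; near: y; exact: lt_nbhsl.
- apply: cvgM; [exact: cvg_id | exact: continuous_ln].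
rewrite /continuous_at mul0r.
have bnd (y : R) : 0 < y -> y <= 1 -> - (y * ln y) <= 2 * Num.sqrt y.
  move=> y0 y1; have s0 : 0 < Num.sqrt y by rewrite sqrtr_gt0.
  have := @ln_sublinear R (Num.sqrt y)^-1; rewrite invr_gt0 => /(_ s0).
  rewrite lnV ?posrE // => /ltW /(ler_wpM2l (ltW y0)).
  have yE : y = Num.sqrt y ^+ 2 by rewrite sqr_sqrtr // ltW.
  have lnE : ln y = 2 * ln (Num.sqrt y).
    by rewrite {1}yE lnXn // mulr_natl.
  rewrite (_ : y / _ = Num.sqrt y); last first.
    by rewrite {1}yE; field; rewrite gt_eqF.
  rewrite lnE; lra.
have sqrt_cvg : (fun y : R => 2 * Num.sqrt y) @ (0 : R) --> (0 : R).
  rewrite -[X in _ --> X](mulr0 2) -[X in 2 * X](sqrtr0 R).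
  by apply: cvgM; [exact: cvg_cst | exact: sqrt_continuous].
(* ln (1 / sqrt y) < 1 / sqrt y yields |y ln y| <= 2 sqrt y near 0. *)
apply: (@squeeze_cvgr _ _ _ _
  (fun y => - (2 * Num.sqrt y)) (fun y => 2 * Num.sqrt y)).
- near=> y; have [y0|y0] := ltP 0 y; last first.
    by rewrite ln0 // mulr0 oppr_le0 mulr_ge0 ?sqrtr_ge0.
  have y1 : y <= 1 by apply: ltW; near: y; exact: lt_nbhsl.
  apply/andP; split.
    by rewrite lerNl bnd.
  apply: (@le_trans _ _ 0); last by rewrite mulr_ge0 ?sqrtr_ge0.
  by apply: mulr_ge0_le0; [exact: ltW | exact: ln_le0].
- by rewrite -[X in _ --> X]oppr0; exact: cvgN.
- exact: sqrt_cvg.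
Unshelve. all: by end_near.
Qed.

Lemma entropy_concave {n : nat} (t : R) (x y : 'cV[R]_n) : 0 <= t <= 1 ->
    (forall i, 0 <= x i ord0) -> (forall i, 0 <= y i ord0) ->
  entropy x + t * (entropy y - entropy x) <= entropy (x + t *: (y - x)).
Proof.
move=> t01 x0 y0; rewrite /entropy.
rewrite [leLHS](_ : _ = - \sum_i (x i ord0 * ln (x i ord0)
    + t * (y i ord0 * ln (y i ord0) - x i ord0 * ln (x i ord0)))); last first.
  by rewrite big_split /= -mulr_sumr sumrB; ring.
by rewrite lerN2; apply: ler_sum => i _; rewrite !mxE xlnx_convex.
Qed.

End Entropy.

(** * Continuity of the inner product, linear maps and the entropy *)

Section Continuity.
Context {R : realType}.

Lemma sum_continuous {T : topologicalType} {n : nat} (f : 'I_n -> T -> R) :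
  (forall i, continuous (f i)) -> continuous (fun x => \sum_i f i x).
Proof.
move=> cf; apply: continuous_big => [|i _]; last exact: cf.
exact: add_continuous.
Qed.

Lemma dot_continuous {T : topologicalType} {n : nat} (f g : T -> 'cV[R]_n) :
    (forall i, continuous (fun x => f x i ord0)) ->
    (forall i, continuous (fun x => g x i ord0)) ->
  continuous (fun x => dot (f x) (g x)).
Proof.
move=> cf cg; under eq_fun do rewrite dotE.
by apply: sum_continuous => i x; apply: cvgM; [exact: cf|exact: cg].
Qed.

Lemma mulmx_coord_continuous {m n : nat} (A : 'M[R]_(m, n)) i :
  continuous (fun x : 'cV[R]_n => (A *m x) i ord0).
Proof.
under eq_fun do rewrite mxE.
apply: sum_continuous => j x.
apply: (@cvgM _ _ (nbhs x) _ (fun=> A i j) (fun y : 'cV[R]_n => y j ord0)).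
  exact: cvg_cst.
exact: coord_continuous.
Qed.

Lemma entropy_continuous {n : nat} : continuous (@entropy R n).
Proof.
suff c : continuous (fun x : 'cV[R]_n => \sum_i x i ord0 * ln (x i ord0)).
  by move=> x; have := cvgN (c x); exact.
apply: sum_continuous => i x.
apply: (@cvg_comp _ _ _ (fun x : 'cV[R]_n => x i ord0) (fun a => a * ln a)).
  exact: coord_continuous.
exact: xlnx_continuous.
Qed.

End Continuity.

Lemma ereal_inf_argmin {T : Type} {R : realType} (A : set T) (f : T -> \bar R)
  (x : T) : argmin A f x -> ereal_inf [set f y | y in A] = f x.
Proof.
move=> [Ax fx]; apply/eqP; rewrite eq_le; apply/andP; split.
  by apply: ereal_inf_lbound; exists x.
by apply: le_ereal_inf_tmp => _ [y Ay <-]; exact: fx.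
Qed.

Lemma ereal_sup_argmax {T : Type} {R : realType} (A : set T) (f : T -> \bar R)
  (x : T) : argmax A f x -> ereal_sup [set f y | y in A] = f x.
Proof.
move=> [Ax fx]; apply/eqP; rewrite eq_le; apply/andP; split.
  by apply: ge_ereal_sup => _ [y Ay <-]; exact: fx.
by apply: ereal_sup_ubound; exists x.
Qed.

Lemma continuous_addZ {R : realType} {T : topologicalType} (c : R)
    (f g : T -> R) :
  continuous f -> continuous g -> continuous (fun x => f x + c * g x).
Proof.
move=> cf cg x; apply: cvgD; first exact: cf.
by apply: cvgM; [exact: cvg_cst | exact: cg].
Qed.

Lemma Qobj_continuous {R : realType} {k : nat} (eps : R) (M : 'M[R]_k) :
  continuous (Qobj eps M).
Proof.
have cM : continuous (fun x => dot x (M *m x)).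
  apply: dot_continuous => i; first exact: coord_continuous.
  exact: mulmx_coord_continuous.
have c0 : continuous (fun _ : 'cV[R]_k => 0 : R) by exact: cst_continuous.
have c1 := continuous_addZ 2^-1 _ _ c0 cM.
have c2 := continuous_addZ (- eps) _ _ c1 (@entropy_continuous R k).
rewrite (_ : Qobj eps M = fun x => 0 + 2^-1 * dot x (M *m x)
    + - eps * entropy x); last by apply/funext => x; rewrite /Qobj; ring.
exact: c2.
Qed.

(** * Two completions of the square *)

Section Duality.
Context {R : realType} {k r0 r1 : nat} (eps : R).
Context (B0 : 'M[R]_(r0, k)) (B1 : 'M[R]_(r1, k)).
Implicit Types (u : 'cV[R]_r0) (v : 'cV[R]_r1) (x y : 'cV[R]_k).

(** For fixed [x] this is the maximum over [v] of the expression in (V) before the infimum over [x],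
    attained at [v = B1 *m x]. *)
Definition Pobj u x : R :=
  2^-1 * dot u u + 2^-1 * dot (B1 *m x) (B1 *m x) - dot u (B0 *m x)
  - eps * entropy x.

Lemma innerobjE u v x : innerobj eps B0 B1 u v x =
  dot v (B1 *m x) - dot u (B0 *m x) - eps * entropy x.
Proof. by rewrite /innerobj dotBl !dot_trmx. Qed.

(** Completes the square in [v]. *)
Lemma Pobj_innerobj u v x :
  2^-1 * dot u u - 2^-1 * dot v v + innerobj eps B0 B1 u v x
  = Pobj u x - 2^-1 * dot (v - B1 *m x) (v - B1 *m x).
Proof.
rewrite innerobjE /Pobj !(dotBl, dotBr) (dotC (B1 *m x) v); by field.
Qed.

(** Completes the square in [u]; the concave part of [M], coming from [B0], is absorbed into the
    square. *)
Lemma Pobj_Qobj u x : Pobj u x =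
  Qobj eps (B1^T *m B1 - B0^T *m B0) x
  + 2^-1 * dot (u - B0 *m x) (u - B0 *m x).
Proof.
rewrite /Pobj /Qobj mulmxBl -!mulmxA dotBr !(dotC x) !dot_trmx.
by rewrite !(dotBl, dotBr) (dotC (B0 *m x) u); field.
Qed.

Lemma Pobj_continuous u : continuous (Pobj u).
Proof.
have cB1 : continuous (fun x => dot (B1 *m x) (B1 *m x)).
  by apply: dot_continuous => i; exact: mulmx_coord_continuous.
have cB0 : continuous (fun x => dot u (B0 *m x)).
  apply: dot_continuous => i; last exact: mulmx_coord_continuous.
  by move=> x; exact: cst_continuous.
have cH := @entropy_continuous R k.
have cc : continuous (fun _ : 'cV[R]_k => 2^-1 * dot u u).
  exact: cst_continuous.
rewrite (_ : Pobj u = fun x => 2^-1 * dot u u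
    + 2^-1 * dot (B1 *m x) (B1 *m x) + -1 * dot u (B0 *m x)
    + - eps * entropy x); last by apply/funext => x; rewrite /Pobj; ring.
have c1 := continuous_addZ 2^-1 _ _ cc cB1.
have c2 := continuous_addZ (-1) _ _ c1 cB0.
have c3 := continuous_addZ (- eps) _ _ c2 cH.
exact: c3.
Qed.

(** * The inner supremum for a convex set [K] of nonnegative vectors *)

Context (K : set 'cV[R]_k).
Context (eps_ge0 : 0 <= eps).
Context (K_ge0 : forall x, K x -> forall i, 0 <= x i ord0).
Context (K_convex : forall x y (t : R), K x -> K y -> 0 <= t <= 1 ->
  K (x + t *: (y - x))).

(* Moving from x to x + t (y - x) changes Pobj u by at most
   - t D + t^2 q / 2, where D is the gap of the inner objective; minimality at
   t = D / (q + D) forces D <= 0. *)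
Lemma argmin_Pobj_innerobj u x : argmin K (Pobj u) x ->
  argmin K (innerobj eps B0 B1 u (B1 *m x)) x.
Proof.
move=> [Kx minx]; split=> // y Ky; rewrite leNgt; apply/negP => lt_yx.
set D := innerobj eps B0 B1 u (B1 *m x) x - innerobj eps B0 B1 u (B1 *m x) y.
have D0 : 0 < D by rewrite subr_gt0.
set q := dot (B1 *m (y - x)) (B1 *m (y - x)).
have q0 : 0 <= q by exact: dot_ge0.
have incr (t : R) : 0 <= t <= 1 -> t * D <= 2^-1 * t ^+ 2 * q.
  move=> t01; have := minx _ (K_convex _ _ _ Kx Ky t01).
  have := entropy_concave t x y t01 (K_ge0 _ Kx) (K_ge0 _ Ky).
  move=> /(ler_wpM2l eps_ge0).
  rewrite /D /q !innerobjE /Pobj.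
  rewrite mulmxDr -!scalemxAr !mulmxBr.
  rewrite mulmxDr -scalemxAr mulmxBr.
  rewrite !(dotBl, dotBr, dotDl, dotDr, dotZl, dotZr).
  rewrite (dotC (B1 *m y) (B1 *m x)).
  move: (dot _ _) (dot _ _) (dot _ _) (dot _ _) (dot _ _) (dot _ _).
  move: (entropy x) (entropy y) (entropy _) => hx hy hz a b c d e f h1 h2.
  lra.
have qD : 0 < q + D by rewrite ltr_wpDl.
set t := D / (q + D).
have t0 : 0 < t by rewrite divr_gt0.
have tqD : t * (q + D) = D by rewrite divfK ?gt_eqF.
have t1 : t <= 1 by rewrite ler_pdivrMr // mul1r lerDr.
have : t * D <= 2^-1 * t ^+ 2 * q by apply: incr; rewrite t1 ltW.
(* Dividing by [t] leaves [D <= t * q / 2], while [t * (q + D) = D] gives [t * q <= D]; hence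
   [D <= D / 2], against [D0]. *)
rewrite (_ : 2^-1 * _ * q = t * (2^-1 * (t * q))); last by ring.
rewrite ler_pM2l // => leD.
have tq : t * q <= D by rewrite -[leRHS]tqD ler_pM2l // lerDl ltW.
lra.
Qed.

(** Weak duality: the infimum over [K] is at most its value at one point. *)
Lemma Vobj_le u v x : K x -> (Vobj eps B0 B1 K u v <=
  (Pobj u x - 2^-1 * dot (v - B1 *m x) (v - B1 *m x))%:E)%E.
Proof.
move=> Kx; rewrite -Pobj_innerobj EFinD leeD2l //.
by apply: ereal_inf_lbound; exists x.
Qed.

(** No duality gap: [x] also minimizes the inner objective at [v = B1 *m x], where the square
    vanishes. *)
Lemma Vobj_argmin u x : argmin K (Pobj u) x ->
  Vobj eps B0 B1 K u (B1 *m x) = (Pobj u x)%:E.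
Proof.
move=> minx; have [Kx min_inner] := argmin_Pobj_innerobj _ _ minx.
rewrite /Vobj (@ereal_inf_argmin _ _ _ _ x); last first.
  by split=> // y Ky; rewrite lee_fin min_inner.
by rewrite -EFinD Pobj_innerobj subrr /dot mulmx0 mxE mulr0 subr0.
Qed.

(** [W] is left general so that the same argument serves the whole space and the image of [K]. *)
Lemma argmax_Vobj (W : set 'cV[R]_r1) u x : argmin K (Pobj u) x ->
  W (B1 *m x) -> argmax W (Vobj eps B0 B1 K u) (B1 *m x).
Proof.
move=> minx Wx; split=> // v _; rewrite (Vobj_argmin _ _ minx).
apply: le_trans (Vobj_le _ _ _ minx.1) _.
by rewrite lee_fin lerBlDr lerDl mulr_ge0 ?dot_ge0.
Qed.

(** The upper bound falls short of the maximum by half the squared distance from [v] to [B1 *m x],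
    so that distance is 0. *)
Lemma argmax_Vobj_unique (W : set 'cV[R]_r1) u v x : argmin K (Pobj u) x ->
  W (B1 *m x) -> argmax W (Vobj eps B0 B1 K u) v -> v = B1 *m x.
Proof.
move=> minx Wx [_ /(_ (B1 *m x) Wx)]; rewrite (Vobj_argmin _ _ minx).
move=> /le_trans /(_ (Vobj_le _ _ _ minx.1)); rewrite lee_fin => le0.
apply/eqP; rewrite -subr_eq0; apply/eqP/dot_eq0/eqP.
have d0 := dot_ge0 (v - B1 *m x).
rewrite eq_le d0 andbT; lra.
Qed.

Lemma Vsup_argmin (W : set 'cV[R]_r1) u x : argmin K (Pobj u) x ->
  W (B1 *m x) -> Vsup eps B0 B1 K W u = (Pobj u x)%:E.
Proof.
move=> minx Wx; rewrite /Vsup.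
rewrite (ereal_sup_argmax _ _ _ (argmax_Vobj _ _ _ minx Wx)).
exact: Vobj_argmin.
Qed.

Let M := B1^T *m B1 - B0^T *m B0.

Lemma Qobj_le_Pobj u x : Qobj eps M x <= Pobj u x.
Proof. by rewrite Pobj_Qobj lerDl mulr_ge0 ?dot_ge0. Qed.

Lemma Pobj_mulmx x : Pobj (B0 *m x) x = Qobj eps M x.
Proof. by rewrite Pobj_Qobj subrr /dot mulmx0 mxE mulr0 addr0. Qed.

(** At [u = B0 *m x] the added square vanishes at [x] and is nonnegative elsewhere. *)
Lemma argmin_Qobj_Pobj x : argmin K (Qobj eps M) x ->
  argmin K (Pobj (B0 *m x)) x.
Proof.
move=> [Kx minx]; split=> // y Ky; rewrite Pobj_mulmx.
exact: le_trans (minx y Ky) (Qobj_le_Pobj _ _).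
Qed.

(** * The outer inf-sup problem over [U] and [W] *)

Context (K_argmin : forall f : 'cV[R]_k -> R, continuous f ->
  exists x, argmin K f x).
Context (U : set 'cV[R]_r0) (W : set 'cV[R]_r1).
Context (B0K_U : [set B0 *m x | x in K] `<=` U).
Context (B1K_W : [set B1 *m x | x in K] `<=` W).

(** [Vsup] at any [u] is the minimum of [Pobj u] over [K], hence at least the minimum of (Q), which
    is reached at [u = B0 *m x]. *)
Lemma argmin_Vsup x : argmin K (Qobj eps M) x ->
  argmin U (Vsup eps B0 B1 K W) (B0 *m x).
Proof.
move=> minx; have Kx := minx.1; split; first by apply: B0K_U; exists x.
have Wx : W (B1 *m x) by apply: B1K_W; exists x.
move=> u _; have [y miny] := K_argmin _ (Pobj_continuous u).
have Wy : W (B1 *m y) by apply: B1K_W; exists y => //; exact: miny.1.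
rewrite (Vsup_argmin _ _ _ (argmin_Qobj_Pobj _ minx) Wx).
rewrite (Vsup_argmin _ _ _ miny Wy) lee_fin Pobj_mulmx.
exact: le_trans (minx.2 y miny.1) (Qobj_le_Pobj _ _).
Qed.

Lemma Vvalue_argmin x : argmin K (Qobj eps M) x ->
  Vvalue eps B0 B1 K U W = (Qobj eps M x)%:E.
Proof.
move=> minx; rewrite /Vvalue (ereal_inf_argmin _ _ _ (argmin_Vsup _ minx)).
rewrite (Vsup_argmin _ _ _ (argmin_Qobj_Pobj _ minx)) ?Pobj_mulmx //.
by apply: B1K_W; exists x => //; exact: minx.1.
Qed.

(** The right side does not mention [U] or [W], so the full and the restricted problems have the
    same solutions. *)
Lemma VsolvesP u v : Vsolves eps B0 B1 K U W u v <->
  exists x, [/\ argmin K (Qobj eps M) x, argmin K (Pobj u) x,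
    u = B0 *m x & v = B1 *m x].
Proof.
split=> [[[Uu minu] maxv]|[x [minx minPx -> ->]]]; last first.
  split; first exact: argmin_Vsup.
  apply: argmax_Vobj; first exact: argmin_Qobj_Pobj.
  by apply: B1K_W; exists x => //; exact: minx.1.
have [x minx] := K_argmin _ (Pobj_continuous u); exists x.
have Kx := minx.1.
have Wx : W (B1 *m x) by apply: B1K_W; exists x.
(* Compares [u] with the competitor [B0 *m y], whose inner supremum is at most [Pobj (B0 *m y) y],
   the value of (Q) at [y]. *)
have Qx y : K y -> Pobj u x <= Qobj eps M y.
  move=> Ky; have [z minz] := K_argmin _ (Pobj_continuous (B0 *m y)).
  have Wz : W (B1 *m z) by apply: B1K_W; exists z => //; exact: minz.1.
  have Uy : U (B0 *m y) by apply: B0K_U; exists y.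
  have := minu _ Uy; rewrite (Vsup_argmin _ _ _ minx Wx).
  rewrite (Vsup_argmin _ _ _ minz Wz) lee_fin => /le_trans; apply.
  by rewrite -Pobj_mulmx; exact: minz.2.
split=> //.
- by split=> // y Ky; exact: le_trans (Qobj_le_Pobj _ _) (Qx y Ky).
(* At [y = x] the bound [Qx] leaves no room for the square in [Pobj_Qobj]. *)
- apply/eqP; rewrite -subr_eq0; apply/eqP/dot_eq0/eqP.
  rewrite eq_le dot_ge0 andbT; have := Qx x Kx; rewrite Pobj_Qobj -/M; lra.
- exact: argmax_Vobj_unique minx Wx maxv.
Qed.

End Duality.

(** * Decomposition of a symmetric matrix *)

Section Decomposition.
Context {R : realType}.

(** Induction on the size: the Schur complement of the top left entry is again symmetric and
    positive definite. *)
Lemma cholesky {n : nat} (A : 'M[R]_n) : A^T = A ->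
    (forall x : 'cV[R]_n, x != 0 -> 0 < dot x (A *m x)) ->
  exists B : 'M[R]_n, A = B^T *m B.
Proof.
elim: n A => [|n IHn] A A_sym A_pos.
  by exists 0; apply/matrixP => -[].
move: A A_sym A_pos; rewrite -[n.+1]/(1 + n)%N => A A_sym A_pos.
set a := A 0 0; set b : 'rV_n := ursubmx A; set C := drsubmx A.
have AE : A = block_mx a%:M b b^T C.
  rewrite -[LHS]submxK; congr block_mx.
    by rewrite [LHS]mx11_scalar /a !mxE !lshift0.
  by rewrite /b trmx_ursub A_sym.
have C_sym : C^T = C by rewrite /C trmx_drsub A_sym.
have dotA c (y : 'cV[R]_n) : dot (col_mx c%:M y) (A *m col_mx c%:M y)
    = a * c ^+ 2 + 2 * c * (b *m y) 0 0 + dot y (C *m y).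
  rewrite AE mul_block_col /dot tr_col_mx mul_row_col !mulmxDr.
  rewrite tr_scalar_mx -scalar_mxM !mul_scalar_mx !mul_mx_scalar.
  rewrite -scalemxAr.
  have -> : y^T *m b^T = b *m y.
    by rewrite -trmx_mul [b *m y]mx11_scalar tr_scalar_mx.
  by rewrite !mxE eqxx mulr1n; ring.
have a_gt0 : 0 < a.
  have := A_pos (col_mx 1%:M 0); rewrite dotA mulmx0 /dot trmx0 mul0mx !mxE.
  rewrite mulr0 !addr0 expr1n mulr1; apply.
  rewrite col_mx_eq0 negb_and; apply/orP; left.
  exact: (oner_neq0 'M[R]_1).
have [||B CE] := IHn (C - a^-1 *: (b^T *m b)).
- by rewrite linearB linearZ /= trmx_mul trmxK C_sym.
(* This first coordinate minimizes the quadratic form for given [y]; the minimum is the form of the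
   Schur complement. *)
- move=> y y0; have := A_pos (col_mx (- a^-1 * (b *m y) 0 0)%:M y).
  rewrite dotA col_mx_eq0 negb_and y0 orbT => /(_ isT).
  rewrite mulmxBl dotBr -scalemxAl dotZr -mulmxA.
  rewrite [dot y (b^T *m _)]dotC dot_trmx.
  rewrite (dotE (b *m y)) big_ord1; move: ((b *m y) 0 0) => s.
  rewrite (_ : a * _ + _ = - (a^-1 * (s * s))); first by lra.
  by field; rewrite gt_eqF.
exists (block_mx (Num.sqrt a)%:M ((Num.sqrt a)^-1 *: b) 0 B).
rewrite AE tr_block_mx mulmx_block.
have sa : Num.sqrt a != 0 by rewrite gt_eqF // sqrtr_gt0.
rewrite !trmx0 !mul0mx !mulmx0 !addr0 tr_scalar_mx -scalar_mxM.
rewrite -expr2 sqr_sqrtr ?ltW // linearZ /= mul_scalar_mx mul_mx_scalar.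
rewrite !linearZ /= -!scalemxAl -?scalemxAr !scalerA mulfV // mulVf // !scale1r.
by rewrite -expr2 exprVn sqr_sqrtr ?ltW // -CE addrC subrK.
Qed.

(** Both factors are square, which gives the bounds on [r0] and [r1]. *)
Lemma symmetric_decomposition {n : nat} (M : 'M[R]_n) : M^T = M ->
  exists (B0 B1 : 'M[R]_n), M = B1^T *m B1 - B0^T *m B0.
Proof.
(* The sum of the absolute entries bounds the negative part of the quadratic form; the extra 1 makes
   the shifted form strictly positive. *)
move=> M_sym; set c := 1 + \sum_i \sum_j `|M i j|.
have c0 : 0 < c by rewrite ltr_pwDl // sumr_ge0 // => i _; rewrite sumr_ge0.
have [||B1 B1E] := cholesky (M + c%:M).
- by rewrite linearD /= M_sym tr_scalar_mx.
- move=> x x0; rewrite mulmxDl mul_scalar_mx dotDr dotZr.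
  have xx0 : 0 < dot x x.
    rewrite lt_def dot_ge0 andbT; apply: contra x0 => /eqP xx.
    by apply/eqP/dot_eq0.
  suff : - (c - 1) * dot x x <= dot x (M *m x) by lra.
  rewrite /c [1 + _]addrC addrK [leRHS]dotE -sumrN mulr_suml.
  apply: ler_sum => i _; rewrite mxE mulr_sumr -sumrN mulr_suml.
  apply: ler_sum => j _.
  have xi l : x l ord0 ^+ 2 <= dot x x.
    rewrite dotE (bigD1 l) //= -expr2 lerDl sumr_ge0 // => m _.
    by rewrite -expr2 sqr_ge0.
  have /(ler_wpM2l (normr_ge0 (M i j))) : `|x i ord0 * x j ord0| <= dot x x.
    have := xi i; have := xi j; rewrite normrM.
    rewrite -(real_normK (num_real (x i _))) -(real_normK (num_real (x j _))).
    (* Arithmetic-geometric mean inequality for the two coordinates. *)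
    have := sqr_ge0 (`|x i ord0| - `|x j ord0|).
    nra.
  rewrite -normrM mulNr lerNl => /(le_trans _); apply.
  rewrite -normrN; apply: le_trans (ler_norm _) _.
  by rewrite le_eqVlt; apply/orP; left; apply/eqP; congr `|_|; ring.
exists (Num.sqrt c)%:M, B1.
rewrite tr_scalar_mx -scalar_mxM -expr2 sqr_sqrtr ?ltW // -B1E.
by rewrite addrK.
Qed.

End Decomposition.

(** * Minimizers on closed subsets of the unit cube *)

Lemma trmx_continuous {R : realType} {m n : nat} :
  continuous (@trmx R m n).
Proof.
move=> x A [P xP PA]; exists (fun i j => P j i) => [i j|y yP].
  by have := xP j i; rewrite mxE.
by apply: PA => i j; rewrite mxE; exact: yP.
Qed.

(** Extreme value theorem on a closed part of the compact cube. [rV_compact] concerns row vectors,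
    so the argument runs on the transposed set [A]. *)
Lemma cV_box_argmin {R : realType} {n : nat} (K : set 'cV[R]_n)
    (f : 'cV[R]_n -> R) :
    K !=set0 -> closed K -> (forall x i, K x -> 0 <= x i ord0 <= 1) ->
    continuous f ->
  exists x, argmin K f x.
Proof.
move=> [x0 Kx0] K_closed K_box f_cont.
set A : set 'rV[R]_n := trmx @^-1` K.
have A_compact : compact A.
  apply: (@subclosed_compact _ A [set y : 'rV[R]_n |
    forall i, `[0, 1]%classic (y ord0 i)]).
  - exact: (continuous_closedP trmx).1 trmx_continuous _ K_closed.
  - by have := @rV_compact R n (fun=> `[0 : R, 1 : R]%classic)
      (fun=> @segment_compact R 0 1); exact.
  - move=> y Ay i; have := K_box _ i Ay.
    by rewrite mxE /= in_itv /=.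
have [||y yA miny] := @compact_EVT_min _ _ (f \o trmx) A _ A_compact.
- by exists x0^T; rewrite /A /= trmxK.
- apply: continuous_subspaceT => y.
  apply: continuous_comp; [exact: trmx_continuous | exact: f_cont].
exists y^T; split; first by move: yA; rewrite inE.
move=> x Kx; have := miny x^T; rewrite /= trmxK; apply.
by rewrite inE /A /= trmxK.
Qed.

(** * The polytope of couplings *)

Section Couplings.
Context {R : realType} {d0 d1 : measure_display}.
Context {T0 : measurableType d0} {T1 : measurableType d1} {N0 N1 : nat}.
Context (p0 : 'I_N0 -> T0) (p1 : 'I_N1 -> T1).
Context (mu0 : probability T0 R) (mu1 : probability T1 R).
Context (p0_bij : bijective p0) (p1_bij : bijective p1).
Context (T0_discrete : forall A : set T0, measurable A).
Context (T1_discrete : forall A : set T1, measurable A).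

Let K := couplings p0 p1 mu0 mu1.
Let w0 i := fine (mu0 [set p0 i]).
Let w1 j := fine (mu1 [set p1 j]).

(** Singletons are measurable and have finite mass, so the marginal conditions become linear
    equations over the reals. *)
Lemma couplingsE : K = [set x | [/\ forall l, 0 <= x l ord0,
  forall i, \sum_(j < N1) x (mxvec_index i j) ord0 = w0 i &
  forall j, \sum_(i < N0) x (mxvec_index i j) ord0 = w1 j]].
Proof.
apply/seteqP; split=> x [x0 x1 x2]; split=> //.
- by move=> i; rewrite /w0 -x1.
- by move=> j; rewrite /w1 -x2.
- by move=> i; rewrite x1 fineK // fin_num_measure.
- by move=> j; rewrite x2 fineK // fin_num_measure.
Qed.

Lemma couplings_ge0 x : K x -> forall l, 0 <= x l ord0.
Proof. by case. Qed.

Lemma couplings_convex x y (t : R) : K x -> K y -> 0 <= t <= 1 ->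
  K (x + t *: (y - x)).
Proof.
rewrite couplingsE => -[x0 x1 x2] [y0 y1 y2] /andP[t0 t1]; split.
- move=> l; rewrite !mxE.
  rewrite (_ : _ + _ = (1 - t) * x l ord0 + t * y l ord0); last by ring.
  by rewrite addr_ge0 ?mulr_ge0 ?subr_ge0.
- move=> i; under eq_bigr do rewrite !mxE.
  by rewrite big_split /= -mulr_sumr sumrB x1 y1 subrr mulr0 addr0.
- move=> j; under eq_bigr do rewrite !mxE.
  by rewrite big_split /= -mulr_sumr sumrB x2 y2 subrr mulr0 addr0.
Qed.

(** An intersection of closed half-spaces and hyperplanes. *)
Lemma couplings_closed : closed K.
Proof.
have closed_sum (n N : nat) (h : 'I_N -> 'I_n) (c : R) :
    closed [set x : 'cV[R]_n | \sum_j x (h j) ord0 = c].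
  have h_cont : continuous (fun x : 'cV[R]_n => \sum_j x (h j) ord0).
    by apply: sum_continuous => j; exact: coord_continuous.
  by have := (continuous_closedP _).1 h_cont _ (@closed_eq R c); exact.
rewrite couplingsE [X in closed X](_ : _ =
  \bigcap_(l in setT) [set x : 'cV[R]_(N0 * N1) | 0 <= x l ord0] `&`
  (\bigcap_(i in setT) [set x : 'cV[R]_(N0 * N1) |
     \sum_j x (mxvec_index i j) ord0 = w0 i] `&`
   \bigcap_(j in setT) [set x : 'cV[R]_(N0 * N1) |
     \sum_i x (mxvec_index i j) ord0 = w1 j])); last first.
  apply/seteqP; split=> x.
    move=> [x0 x1 x2]; split=> [l _|]; first exact: x0.
    by split=> i _; [exact: x1 | exact: x2].
  by move=> [x0 [x1 x2]]; split=> i; [exact: x0 | exact: x1 | exact: x2].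
apply: closedI; last first.
  by apply: closedI; apply: closed_bigI => i _; exact: closed_sum.
apply: closed_bigI => l _.
have l_cont := @coord_continuous R _ 1 l ord0.
have := (continuous_closedP _).1 l_cont _ (@closed_ge R 0).
exact.
Qed.

(** An entry is at most its row sum, the probability of a point. *)
Lemma couplings_le1 x l : K x -> x l ord0 <= 1.
Proof.
move=> [x0 x1 _]; case/mxvec_indexP: l => i j.
apply: (@le_trans _ _ (\sum_(j < N1) x (mxvec_index i j) ord0)).
  by rewrite (bigD1 j) //= lerDl sumr_ge0.
by rewrite -lee_fin x1 probability_le1.
Qed.

(** The enumerated singletons partition the space. *)
Lemma sum_probability_atoms {d : measure_display} {T : measurableType d}
    {N : nat} (p : 'I_N -> T) (mu : probability T R) : bijective p ->
    (forall A : set T, measurable A) ->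
  \sum_i fine (mu [set p i]) = 1.
Proof.
move=> [q pK qK] T_discrete; apply: EFin_inj; rewrite -sumEFin.
under eq_bigr => i _ do rewrite fineK ?fin_num_measure //.
rewrite -measure_bigsetU_ord // -?(probability_setT mu); last first.
  by move=> i j _ _ [_ [->] /(can_inj pK)].
congr (mu _); apply/seteqP; split=> // x _.
by rewrite -(qK x) (bigD1 (q x)) //=; left.
Qed.

Lemma couplings_nonempty : K !=set0.
Proof.
(* The product coupling. *)
exists (mxvec (\matrix_(i, j) (w0 i * w1 j)))^T; rewrite couplingsE.
have xE i j : (mxvec (\matrix_(i, j) (w0 i * w1 j)))^T (mxvec_index i j) ord0
    = w0 i * w1 j by rewrite mxE mxvecE mxE.
split.
- by case/mxvec_indexP => i j; rewrite xE mulr_ge0 // fine_ge0.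
- move=> i; under eq_bigr do rewrite xE.
  by rewrite -mulr_sumr sum_probability_atoms // mulr1.
- move=> j; under eq_bigr do rewrite xE.
  by rewrite -mulr_suml sum_probability_atoms // mul1r.
Qed.

Lemma couplings_argmin (f : 'cV[R]_(N0 * N1) -> R) :
  continuous f -> exists x, argmin K f x.
Proof.
apply: cV_box_argmin; [exact: couplings_nonempty | exact: couplings_closed |].
by move=> x i Kx; rewrite couplings_ge0 ?couplings_le1.
Qed.

End Couplings.

Theorem theorem1 (R : realType) (d0 d1 : measure_display)
    (T0 : measurableType d0) (T1 : measurableType d1) (N0 N1 : nat)
    (p0 : 'I_N0 -> T0) (p1 : 'I_N1 -> T1)
    (p0_bij : bijective p0) (p1_bij : bijective p1)
    (T0_discrete : forall A : set T0, measurable A)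
    (T1_discrete : forall A : set T1, measurable A)
    (mu0 : probability T0 R) (mu1 : probability T1 R)
    (eps : R) (eps_ge0 : 0 <= eps)
    (M : 'M[R]_(N0 * N1)) (M_sym : M^T = M) :
  (exists (r0 r1 : nat) (B0 : 'M[R]_(r0, N0 * N1)) (B1 : 'M[R]_(r1, N0 * N1)),
    [/\ (r0 <= N0 * N1)%N, (r1 <= N0 * N1)%N &
        M = B1^T *m B1 - B0^T *m B0]) /\
  (forall (r0 r1 : nat) (B0 : 'M[R]_(r0, N0 * N1)) (B1 : 'M[R]_(r1, N0 * N1)),
    (r0 <= N0 * N1)%N -> (r1 <= N0 * N1)%N ->
    M = B1^T *m B1 - B0^T *m B0 ->
    let K := couplings p0 p1 mu0 mu1 in
    let B0K := [set B0 *m x | x in K] in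
    let B1K := [set B1 *m x | x in K] in
    Vvalue eps B0 B1 K setT setT = Qvalue eps M K /\
    (forall x, argmin K (Qobj eps M) x ->
      Vsolves eps B0 B1 K setT setT (B0 *m x) (B1 *m x) /\
      argmin K (innerobj eps B0 B1 (B0 *m x) (B1 *m x)) x) /\
    (forall u v, Vsolves eps B0 B1 K setT setT u v ->
      exists x, [/\ argmin K (innerobj eps B0 B1 u v) x,
                    argmin K (Qobj eps M) x,
                    u = B0 *m x & v = B1 *m x]) /\
    (forall u, argmax setT (Vobj eps B0 B1 K u) `<=` B1K) /\
    (forall u, Vsup eps B0 B1 K B1K u = Vsup eps B0 B1 K setT u) /\
    Vvalue eps B0 B1 K B0K B1K = Vvalue eps B0 B1 K setT setT /\
    (forall u v, Vsolves eps B0 B1 K B0K B1K u v <->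
                 Vsolves eps B0 B1 K setT setT u v)).
Proof.
split.
  have [B0 [B1 ME]] := symmetric_decomposition M M_sym.
  by exists (N0 * N1)%N, (N0 * N1)%N, B0, B1.
move=> r0 r1 B0 B1 _ _ ME K B0K B1K.
have K_ge0 x : K x -> forall l, 0 <= x l ord0 by exact: couplings_ge0.
have K_convex := couplings_convex p0 p1 mu0 mu1 T0_discrete T1_discrete.
have K_argmin := couplings_argmin _ _ mu0 mu1 p0_bij p1_bij
  T0_discrete T1_discrete.
(* A solution of (Q) exists; the equalities of optimal values are read off at it. *)
have [x minx] := K_argmin _ (Qobj_continuous eps M).
have argmin_inner := argmin_Pobj_innerobj eps B0 B1 K eps_ge0 K_ge0 K_convex.
have solP U W := VsolvesP eps B0 B1 K eps_ge0 K_ge0 K_convex K_argmin U W.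
have valE U W := Vvalue_argmin eps B0 B1 K eps_ge0 K_ge0 K_convex K_argmin U W.
rewrite -ME in solP valE.
have sol_full := solP setT setT (@subsetT _ _) (@subsetT _ _).
have sol_restr := solP B0K B1K (@subset_refl _ _) (@subset_refl _ _).
split; last split; last split; last split; last split; last split.
- rewrite (valE _ _ (@subsetT _ _) (@subsetT _ _) x minx).
  rewrite /Qvalue (ereal_inf_argmin _ (fun y => (Qobj eps M y)%:E) x) //.
- move=> y miny.
  have minPy : argmin K (Pobj eps B0 B1 (B0 *m y)) y.
    by apply: argmin_Qobj_Pobj; rewrite -ME.
  by split; [apply/sol_full; exists y | exact: argmin_inner _ _ minPy].
- move=> u v /sol_full[y [miny minPy uE vE]]; exists y; split=> //; rewrite vE.
  exact: argmin_inner _ _ minPy.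
(* The only maximizer is [B1 *m y], with [y] in [K] minimizing [Pobj u]. *)
- move=> u v maxv; have [y minPy] := K_argmin _ (Pobj_continuous eps B0 B1 u).
  exists y; first exact: minPy.1.
  symmetry.
  exact: (argmax_Vobj_unique eps B0 B1 K eps_ge0 K_ge0 K_convex setT u v y
    minPy).
(* Both suprema equal [Pobj u y], because [B1 *m y] lies in both sets. *)
- move=> u; have [y minPy] := K_argmin _ (Pobj_continuous eps B0 B1 u).
  have VsupE := Vsup_argmin eps B0 B1 K eps_ge0 K_ge0 K_convex _ u y minPy.
  by rewrite !VsupE //; exists y => //; exact: minPy.1.
- rewrite (valE B0K B1K _ _ x minx) //.
  by rewrite (valE _ _ (@subsetT _ _) (@subsetT _ _) x minx).
- by move=> u v; apply: iff_trans (sol_restr u v) (iff_sym (sol_full u v)).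
Qed.
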